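(* Let $\otimes_\alpha$ be a tensor product (of order $l$) of convex bodies with zero in the interior and let $P_i\subset\mathbb{E}_i$, $i=1,\ldots,l$, be convex bodies with $0\in\mathrm{int}(P_i)$. Then, for all bijective linear mappings $T_i:\mathbb{E}_i\to\mathbb{F}_i$, $i=1,\ldots,l$, $$T_1\otimes\cdots\otimes T_l\left(P_1\otimes_\alpha\cdots\otimes_\alpha P_l\right)=T_1P_1\otimes_\alpha\cdots\otimes_\alpha T_lP_l.$$
   Context: A Euclidean space is a finite dimensional real inner product space; $\mathbb{E}_i,\mathbb{F}_i$ denote Euclidean spaces. $\otimes_{i=1}^l\mathbb{E}_i$ carries the scalar product determined by $\langle x^1\otimes\cdots\otimes x^l,y^1\otimes\cdots\otimes y^l\rangle_H=\prod_i\langle x^i,y^i\rangle_{\mathbb{E}_i}$. A convex body is a compact convex set with nonempty interior. The polar of $C$ is $C^\circ=\{y:\sup_{x\in C}\langle x,y\rangle\le1\}$ (with respect to $\langle\cdot,\cdot\rangle_H$ in tensor product spaces). For convex bodies $P_i\subset\mathbb{E}_i$ with $0$ in the interior, $P_1\otimes_\pi\cdots\otimes_\pi P_l:=\mathrm{conv}\{x^1\otimes\cdots\otimes x^l:x^i\in P_i\}$ and $P_1\otimes_\epsilon\cdots\otimes_\epsilon P_l:=(P_1^\circ\otimes_\pi\cdots\otimes_\pi P_l^\circ)^\circ$. A tensor product $\otimes_\alpha$ of order $l$ of convex bodies with zero in the interior assigns to each $l$-tuple of convex bodies $P_i\subset\mathbb{E}_i$ containing $0$ in the interior a convex body $P_1\otimes_\alpha\cdots\otimes_\alpha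 P_l\subset\otimes_{i=1}^l\mathbb{E}_i$ such that (1) $P_1\otimes_\pi\cdots\otimes_\pi P_l\subseteq P_1\otimes_\alpha\cdots\otimes_\alpha P_l\subseteq P_1\otimes_\epsilon\cdots\otimes_\epsilon P_l$; (2) (uniform property) for all linear $T_i:\mathbb{E}_i\to\mathbb{F}_i$ and convex bodies $Q_i\subset\mathbb{F}_i$ with $0$ in the interior and $T_i(P_i)\subseteq Q_i$, $T_1\otimes\cdots\otimes T_l(P_1\otimes_\alpha\cdots\otimes_\alpha P_l)\subseteq Q_1\otimes_\alpha\cdots\otimes_\alpha Q_l$. *)

(* Defs.v *)
From HB Require Import structures.
From mathcomp Require Import all_boot all_order all_algebra.
From mathcomp Require Import all_classical all_reals all_analysis.
From mathcomp Require Import ring lra.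

Set Implicit Arguments.
Unset Strict Implicit.
Unset Printing Implicit Defensive.

Import Order.TTheory GRing.Theory Num.Theory.
Import numFieldNormedType.Exports.

Local Open Scope classical_set_scope.
Local Open Scope ring_scope.

Section DotTheory.
Variables (R : realType) (V : lmodType R) (f : {dot V for @idfun R}).

Lemma dotC u v : f u v = f v u.
Proof. by rewrite (hermC f) expr0 mul1r. Qed.

Lemma dot0r u : f u 0 = 0.
Proof. exact: linear0r. Qed.

Lemma dot_ge0 u : 0 <= f u u.
Proof.
have [->|u0] := eqVneq u 0; first by rewrite linear0r.
exact/ltW/neq0_dnorm_gt0.
Qed.

Lemma dot_eq0 u : f u u = 0 -> u = 0.
Proof.
by move=> fu0; apply/eqP/negPn/negP => /(neq0_dnorm_gt0 (s:=f)); rewrite fu0 ltxx.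
Qed.

Lemma dotZl a u v : f (a *: u) v = a * f u v.
Proof. by rewrite linearZl_LR. Qed.

Lemma dotZr a u v : f u (a *: v) = a * f u v.
Proof. by rewrite dotC dotZl dotC. Qed.

Lemma dot_CS u v : f u v ^+ 2 <= f u u * f v v.
Proof.
have [->|v0] := eqVneq v 0; first by rewrite !dot0r expr0n mulr0.
have vv : 0 < f v v by exact: neq0_dnorm_gt0.
have := dot_ge0 (f v v *: u - f u v *: v).
rewrite linearBl /= 2!linearBr /= !dotZl !dotZr (dotC v u) => h.
rewrite -subr_ge0 -(pmulr_rge0 _ vv).
move: h; congr (_ <= _); ring.
Qed.

Definition dot_norm (u : V) : R := Num.sqrt (f u u).

Lemma dot_normD u v : dot_norm (u + v) <= dot_norm u + dot_norm v.
Proof.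
rewrite /dot_norm -[leRHS]ger0_norm ?addr_ge0 ?sqrtr_ge0// -sqrtr_sqr.
rewrite ler_wsqrtr// sqrrD !sqr_sqrtr ?dot_ge0// linearDl /= 2!linearDr /=.
have : f u v <= Num.sqrt (f u u) * Num.sqrt (f v v).
  rewrite -sqrtrM ?dot_ge0// (le_trans (ler_norm _))// -sqrtr_sqr.
  by rewrite ler_wsqrtr// dot_CS.
by rewrite (dotC v u); lra.
Qed.

Lemma dot_normZ a u : dot_norm (a *: u) = `|a| * dot_norm u.
Proof.
by rewrite /dot_norm dotZl dotZr mulrA -expr2 sqrtrM ?sqr_ge0// sqrtr_sqr.
Qed.

Lemma dot_norm_eq0 u : dot_norm u = 0 -> u = 0.
Proof.
move=> /eqP; rewrite sqrtr_eq0 => u0; apply: dot_eq0; apply/eqP.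
by rewrite eq_le u0 dot_ge0.
Qed.

End DotTheory.

(* The norm, hence the topology, is the one induced by the scalar product. *)
HB.mixin Record NormedModule_isEuclidean (R : realType) E
    of NormedModule R E & Vector R E := {
  inner : {dot E for @idfun R};
  norm_inner : forall x : E, `|x| = Num.sqrt (inner x x)
}.

#[short(type="euclideanType")]
HB.structure Definition Euclidean (R : realType) :=
  {E of NormedModule R E & Vector R E & NormedModule_isEuclidean R E}.

HB.factory Record Vector_isEuclidean (R : realType) E of Vector R E := {
  inner : {dot E for @idfun R}
}.

HB.builders Context R E of Vector_isEuclidean R E.

HB.instance Definition _ := Lmodule_isNormed.Build R E
  (@dot_normD R E inner) (@dot_normZ R E inner) (@dot_norm_eq0 R E inner).
HB.instance Definition _ := NormedModule_isEuclidean.Build R E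
  (fun x => erefl : `|x| = Num.sqrt (inner x x)).

HB.end.

Section OrthonormalBasis.
Variables (R : realType) (E : euclideanType R).

Let orthonormal_family n (e : 'I_n -> E) :=
  forall i j, inner (e i) (e j) = (i == j)%:R.

Let inner_sum n (e : 'I_n -> E) (c : 'I_n -> R) j : orthonormal_family e ->
  inner (\sum_i c i *: e i) (e j) = c j.
Proof.
move=> oe; rewrite dotC linear_sumr (bigD1 j)//= dotZr oe eqxx mulr1.
by rewrite big1 ?addr0// => i ij; rewrite dotZr oe eq_sym (negbTE ij) mulr0.
Qed.

Let orthonormal_extend n (e : 'I_n -> E) : (n < \dim {:E})%N ->
  orthonormal_family e -> exists e' : 'I_n.+1 -> E, orthonormal_family e'.
Proof.
move=> ndim oe; pose U := (<<[tuple e i | i < n]>>)%VS.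
have Ue i : e i \in U by rewrite memv_span//; apply/mapP; exists i; rewrite ?mem_enum.
have [v vU] : exists v, v \notin U.
  apply: contrapT => /forallNP nU.
  have /dimvS : (fullv <= U)%VS by apply/subvP => x _; apply: contrapT => /negP /nU.
  by rewrite leqNgt (leq_ltn_trans (dim_span _))// size_tuple.
pose w := v - \sum_i inner v (e i) *: e i.
have w0 : w != 0.
  apply: contra vU => /eqP/subr0_eq ->.
  by rewrite memv_suml// => i _; rewrite memvZ.
have ww : 0 < inner w w by exact: neq0_dnorm_gt0.
have we i : inner w (e i) = 0 by rewrite /w linearBl /= inner_sum// subrr.
pose u := (Num.sqrt (inner w w))^-1 *: w.
have uu : inner u u = 1.
  rewrite dotZl dotZr mulrA -expr2 exprVn sqr_sqrtr ?(ltW ww)//.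
  by rewrite mulVf ?gt_eqF.
have ue i : inner u (e i) = 0 by rewrite dotZl we mulr0.
exists (fun i => if unlift ord_max i is Some j then e j else u) => i j.
case: unliftP => [i' ->|->]; case: unliftP => [j' ->|->].
- by rewrite oe (inj_eq lift_inj).
- by rewrite dotC ue eq_sym (negbTE (neq_lift _ _)).
- by rewrite ue (negbTE (neq_lift _ _)).
- by rewrite uu eqxx.
Qed.

Lemma orthonormal_basis_exists :
  exists e : 'I_(\dim {:E}) -> E, forall i j, inner (e i) (e j) = (i == j)%:R.
Proof.
suff H n : (n <= \dim {:E})%N -> exists e : 'I_n -> E, orthonormal_family e.
  exact: H (leqnn _).
elim: n => [_|n IHn nE]; first by exists (fun=> 0) => -[].
by have [e oe] := IHn (ltnW nE); exact: orthonormal_extend nE oe.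
Qed.

Definition obasis : 'I_(\dim {:E}) -> E := projT1 (cid orthonormal_basis_exists).

Lemma inner_obasis i j : inner (obasis i) (obasis j) = (i == j)%:R.
Proof. exact: (projT2 (cid orthonormal_basis_exists)). Qed.

Lemma obasis_sum x : x = \sum_i inner x (obasis i) *: obasis i.
Proof.
pose X := [tuple obasis i | i < \dim {:E}].
have Xi (i : 'I_(\dim {:E})) : X`_i = obasis i.
  by rewrite (nth_map i) ?size_enum_ord// nth_ord_enum.
have freeX : free X.
  apply/freeP => k k0 i; rewrite -(inner_sum k i inner_obasis).
  rewrite (_ : \sum_j _ = 0) ?linear0l// -[RHS]k0.
  by apply: eq_bigr => j _; rewrite Xi.
have bX : basis_of fullv X by rewrite basisEfree freeX subvf size_tuple leqnn.
rewrite {1}(coord_basis bX (memvf x)); apply: eq_bigr => i _.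
rewrite Xi; congr (_ *: _); rewrite {2}(coord_basis bX (memvf x)).
rewrite (eq_bigr (fun i => coord X i x *: obasis i)) ?inner_sum//.
  exact: inner_obasis.
by move=> j _; rewrite Xi.
Qed.

Lemma parseval x y : inner x y = \sum_i inner x (obasis i) * inner y (obasis i).
Proof.
rewrite {1}(obasis_sum y) linear_sumr; apply: eq_bigr => i _ /=.
by rewrite dotZr mulrC.
Qed.

End OrthonormalBasis.

Lemma prod_sum_dffun (R : comNzRingType) (I : finType) (J : I -> finType)
    (F : forall i, J i -> R) :
  \prod_i \sum_(m : J i) F i m
    = \sum_(j : {dffun forall i, J i}) \prod_i F i (j i).
Proof.
pose G i : {ffun J i -> R} := [ffun m => F i m].
rewrite (reindex _ (onW_bij _ (@dffun_of_fprod_bij _ J))) /=.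
transitivity (\sum_(t : fprod J) \prod_(i in I) G i (t i)); last first.
  by apply: eq_bigr => t _; apply: eq_bigr => i _; rewrite /G !ffunE.
rewrite big_fprod -(bigA_distr_big_dep _ (fun i => untag 0 (G i))).
by apply: eq_bigr => i _; rewrite -(big_tag (T_ := J) (fun i => G i));
  apply: eq_bigr => m _; rewrite ffunE.
Qed.

Section Tensor.
Variables (R : realType) (l : nat).

(* The tensor product of the Euclidean spaces E i: a tensor is represented by  *)
(* its coordinates in the basis of elementary tensors                          *)
(* obasis (j 0) (x) ... (x) obasis (j (l - 1)), which is orthonormal for       *)
(* <.,.>_H. See inner_tprod, tprod_multilinear and tensor_sum for the          *)
(* characteristic properties.                                                  *)
Definition tensor (E : 'I_l -> euclideanType R) : Type :=
  {ffun {dffun forall i, 'I_(\dim {:E i})} -> R^o}.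

HB.instance Definition _ E := Vector.on (tensor E).

Section Inner.
Variable E : 'I_l -> euclideanType R.

Definition tensor_inner (u v : tensor E) : R := \sum_j u j * v j.

Let tensor_inner_bilinear : bilinear_for *%R (idfun \; *%R) tensor_inner.
Proof.
split=> [v a u u'|u a v v'] /=; rewrite /tensor_inner mulr_sumr -big_split/=;
  apply: eq_bigr => j _; rewrite !ffunE/= /GRing.scale/=; ring.
Qed.

HB.instance Definition _ :=
  bilinear_isBilinear.Build R (tensor E) (tensor E) R *%R (idfun \; *%R)
    tensor_inner tensor_inner_bilinear.

Let tensor_inner_sym u v :
  tensor_inner u v = (-1) ^+ false * idfun (tensor_inner v u).
Proof. by rewrite mul1r; apply: eq_bigr => j _; rewrite mulrC. Qed.

HB.instance Definition _ :=
  isHermitianSesquilinear.Build R (tensor E) false idfun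
    tensor_inner tensor_inner_sym.

Let tensor_inner_gt0 u : u != 0 -> 0 < tensor_inner u u.
Proof.
move=> u0; rewrite lt_neqAle sumr_ge0 ?andbT; last first.
  by move=> j _; rewrite -expr2 sqr_ge0.
apply: contra u0; rewrite eq_sym psumr_eq0; last first.
  by move=> j _; rewrite -expr2 sqr_ge0.
move=> /allP u0; apply/eqP/ffunP => j; rewrite ffunE.
by apply/eqP; have := u0 j; rewrite mem_index_enum mulf_eq0 orbb => /(_ isT).
Qed.

HB.instance Definition _ :=
  isDotProduct.Build R (tensor E) tensor_inner tensor_inner_gt0.

HB.instance Definition _ := Vector_isEuclidean.Build R (tensor E) tensor_inner.

End Inner.

Definition tprod (E : 'I_l -> euclideanType R) (x : forall i, E i) : tensor E :=
  [ffun j : {dffun forall i, 'I_(\dim {:E i})} =>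
     \prod_i inner (x i) (obasis (j i)) : R^o].

Lemma tprod_multilinear (E : 'I_l -> euclideanType R) (x : forall i, E i) i
    (a : R) (y z : E i) :
  tprod (dfwith x i (a *: y + z)) = a *: tprod (dfwith x i y) + tprod (dfwith x i z).
Proof.
apply/ffunP => j; rewrite !ffunE /= /GRing.scale/=.
rewrite (bigD1 i)//= [X in _ = a * X + _](bigD1 i)//=.
rewrite [X in _ = _ + X](bigD1 i)//= !dfwithin linearDl /= dotZl mulrDl mulrA.
by congr (_ * _ + _ * _); apply: eq_bigr => k ki;
  rewrite !dfwithout// eq_sym.
Qed.

Lemma inner_tprod (E : 'I_l -> euclideanType R) (x y : forall i, E i) :
  inner (tprod x) (tprod y) = \prod_i inner (x i) (y i).
Proof.
under [RHS]eq_bigr do rewrite parseval.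
rewrite prod_sum_dffun; apply: eq_bigr => j _.
by rewrite !ffunE -big_split.
Qed.

Lemma tensor_sum (E : 'I_l -> euclideanType R) (u : tensor E) :
  u = \sum_j u j *: tprod (fun i => obasis (j i)).
Proof.
apply/ffunP => k; rewrite sum_ffunE (bigD1 k)//= big1 => [|j jk].
  rewrite !ffunE /GRing.scale/= big1 ?mulr1 ?addr0// => i _.
  by rewrite inner_obasis eqxx.
rewrite !ffunE /GRing.scale/=.
have [i ji] : exists i, j i != k i.
  apply: contrapT => /forallNP jk'; case/eqP: jk; apply/ffunP => i.
  by apply/eqP/negPn/negP/jk'.
by rewrite (bigD1 i)//= inner_obasis (negbTE ji) mul0r mulr0.
Qed.

(* T_0 (x) ... (x) T_(l - 1), defined on the basis; tensor_map_tprod gives its *)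
(* value on all the elementary tensors.                                        *)
Definition tensor_map (E F : 'I_l -> euclideanType R)
    (T : forall i, {linear E i -> F i}) (u : tensor E) : tensor F :=
  \sum_j u j *: tprod (fun i => T i (obasis (j i))).


Let tensor_map_linear (E F : 'I_l -> euclideanType R)
    (T : forall i, {linear E i -> F i}) :
  linear (tensor_map T).
Proof.
move=> a u v; rewrite /tensor_map scaler_sumr -big_split/=.
by apply: eq_bigr => j _; rewrite !ffunE scalerDl scalerA.
Qed.

HB.instance Definition _ (E F : 'I_l -> euclideanType R)
    (T : forall i, {linear E i -> F i}) :=
  GRing.isLinear.Build R (tensor E) (tensor F) *:%R (tensor_map T)
    (tensor_map_linear T).

Lemma tensor_map_tprod (E F : 'I_l -> euclideanType R)
    (T : forall i, {linear E i -> F i})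
    (x : forall i, E i) :
  tensor_map T (tprod x) = tprod (fun i => T i (x i)).
Proof.
apply/ffunP => k; rewrite sum_ffunE [RHS]ffunE.
transitivity (\prod_i \sum_m inner (x i) (obasis m)
                              * inner (T i (obasis m)) (obasis (k i))).
  rewrite prod_sum_dffun; apply: eq_bigr => j _.
  by rewrite !ffunE /GRing.scale/= -big_split.
apply: eq_bigr => i _; rewrite {2}(obasis_sum (x i)) linear_sum/=.
rewrite dotC linear_sumr; apply: eq_bigr => m _ /=.
by rewrite [T i (_ *: _)]linearZ_LR dotZr; congr (_ * _); exact: dotC.
Qed.

End Tensor.

Section ConvexBodies.
Variable R : realType.

Definition convex_body (E : euclideanType R) (C : set E) :=
  [/\ compact C, convex_set C & interior C !=set0].

Definition convex_body0 (E : euclideanType R) (C : set E) :=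
  convex_body C /\ interior C 0.

Definition conv (E : euclideanType R) (A : set E) : set E :=
  smallest (@convex_set R E) A.

Definition polar (E : euclideanType R) (C : set E) : set E :=
  [set y | (ereal_sup [set (inner x y)%:E | x in C] <= 1)%E].

Section Order.
Variable l : nat.

Definition ptensor (E : 'I_l -> euclideanType R) (P : forall i, set (E i)) :
    set (tensor E) :=
  conv [set tprod x | x in [set x : forall i, E i | forall i, P i (x i)]].

Definition etensor (E : 'I_l -> euclideanType R) (P : forall i, set (E i)) :
    set (tensor E) :=
  polar (ptensor (fun i => polar (P i))).

(* alpha is applied to arbitrary sets, but constrained only on convex bodies   *)
(* with zero in the interior.                                                  *)
Record is_tensor_product (alpha : forall E : 'I_l -> euclideanType R,
    (forall i, set (E i)) -> set (tensor E)) : Prop := IsTensorProduct {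
  tensor_convex_body : forall (E : 'I_l -> euclideanType R) (P : forall i, set (E i)),
    (forall i, convex_body0 (P i)) -> convex_body (alpha E P);
  tensor_between : forall (E : 'I_l -> euclideanType R) (P : forall i, set (E i)),
    (forall i, convex_body0 (P i)) ->
    ptensor P `<=` alpha E P /\ alpha E P `<=` etensor P;
  tensor_uniform : forall (E F : 'I_l -> euclideanType R)
      (T : forall i, {linear E i -> F i})
      (P : forall i, set (E i)) (Q : forall i, set (F i)),
    (forall i, convex_body0 (P i)) -> (forall i, convex_body0 (Q i)) ->
    (forall i, T i @` P i `<=` Q i) ->
    tensor_map T @` alpha E P `<=` alpha F Q
}.

End Order.

End ConvexBodies.

(* Main.v *)
From HB Require Import structures.
Require Import Defs.
From mathcomp Require Import all_boot all_order all_algebra.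
From mathcomp Require Import all_classical all_reals all_analysis.

Local Open Scope classical_set_scope.
Local Open Scope ring_scope.

Import Order.TTheory GRing.Theory Num.Theory.
Import numFieldNormedType.Exports.

(** The uniform property applied to [T] gives the inclusion from left to right,
    because [T i] maps [P i] into [T i @` P i]. Applied to the inverse maps
    [S i], which take [T i @` P i] back into [P i], it gives
    [tensor_map S (alpha F (T P)) `<=` alpha E P]; applying [tensor_map T],
    the inverse of [tensor_map S] ([tensor_map_can]), turns this into the
    converse inclusion.

    The uniform property speaks only of convex bodies with zero in the interior,
    so each [T i @` P i] has to be one. That is [convex_body0_image], which rests
    on the continuity of linear maps on a Euclidean space
    ([euclidean_linear_continuous]): continuity of [T i] preserves compactness,
    and continuity of [S i] makes [T i] an open map. *)

Lemma bijective_linear_inverse (R : nzRingType) (U V : lmodType R)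
    (T : {linear U -> V}) :
  bijective T -> exists S : {linear V -> U}, cancel T S /\ cancel S T.
Proof.
move=> [S TK SK].
pose Slin := GRing.isLinear.Build R V U *:%R S (can2_linear TK SK).
by exists (HB.pack_for {linear V -> U} S Slin).
Qed.

Lemma normr_inner_le (R : realType) (E : euclideanType R) (x y : E) :
  `|inner x y| <= `|x| * `|y|.
Proof.
rewrite !norm_inner -sqrtrM ?dot_ge0// -sqrtr_sqr ler_wsqrtr//.
exact: dot_CS.
Qed.

(** Expanding [x] in the orthonormal basis bounds [`|T x|] by [`|x|] times the
    sum of the norms of the images of the basis vectors. *)
Lemma euclidean_linear_continuous (R : realType) (E : euclideanType R)
    (V : normedModType R) (T : {linear E -> V}) : continuous T.
Proof.
have normr_coord_le (y : E) i : `|inner y (obasis i)| <= `|y|.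
  have := normr_inner_le _ _ y (obasis i).
  by rewrite (norm_inner (obasis i)) inner_obasis eqxx sqrtr1 mulr1.
apply/linear_bounded_continuous/linear_boundedP.
near=> r => x; rewrite {1}(obasis_sum x) linear_sum/=.
apply: (le_trans (ler_norm_sum _ _ _)).
apply: (@le_trans _ _ (\sum_i `|T (@obasis R E i)| * `|x|)).
  by apply: ler_sum => i _; rewrite linearZ/= normrZ mulrC ler_wpM2l.
by rewrite -mulr_suml ler_wpM2r//; near: r; apply: nbhs_pinfty_ge.
Unshelve. all: by end_near. Qed.

Lemma convex_set_image (R : numDomainType) (U V : lmodType R)
    (T : {linear U -> V}) (C : set U) :
  @convex_set R U C -> @convex_set R V (T @` C).
Proof.
move=> cC _ _ k /set_mem[x Cx <-] /set_mem[y Cy <-]; apply/mem_set.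
have /set_mem Ck := cC x y k (mem_set Cx) (mem_set Cy).
by exists (convex.conv k (x : convex_lmodType U) y) => //;
  rewrite linearD !linearZ.
Qed.

(** The image of a set under [f] is its preimage under [g], and preimages under
    continuous maps preserve neighborhoods. *)
Lemma interior_image (T U : topologicalType) (f : T -> U) (g : U -> T)
    (A : set T) :
  cancel f g -> cancel g f -> continuous g -> f @` A° `<=` (f @` A)°.
Proof.
move=> fK gK gcont _ [x Ax <-].
have -> : f @` A = g @^-1` A.
  apply/seteqP; split=> [_ [a Aa <-]|y Ay]; first by rewrite /= fK.
  by exists (g y); rewrite ?gK.
by apply: gcont; rewrite fK.
Qed.

Lemma convex_body0_image (R : realType) (E F : euclideanType R)
    (T : {linear E -> F}) (P : set E) :
  bijective T -> convex_body0 P -> convex_body0 (T @` P).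
Proof.
move=> /bijective_linear_inverse[S [TK SK]] [[Pcompact Pconvex _] P0].
have TP0 : (T @` P)° 0.
  apply: (interior_image _ _ _ _ _ TK SK (euclidean_linear_continuous _ _ _ S)).
  by exists 0 => //; rewrite linear0.
split=> //; split; last by exists 0.
- apply: continuous_compact => //; apply: continuous_subspaceT.
  exact: euclidean_linear_continuous.
- exact: convex_set_image.
Qed.

(** Functoriality, checked on the elementary tensors of basis vectors, which
    span. *)
Lemma tensor_map_can (R : realType) (l : nat) (E F : 'I_l -> euclideanType R)
    (T : forall i, {linear E i -> F i}) (S : forall i, {linear F i -> E i}) :
  (forall i, cancel (T i) (S i)) -> cancel (tensor_map T) (tensor_map S).
Proof.
move=> TK u; rewrite {2}/tensor_map linear_sum/=.
rewrite [RHS]tensor_sum; apply: eq_bigr => j _.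
rewrite linearZ/= tensor_map_tprod; congr (_ *: tprod _).
by apply: functional_extensionality_dep => i; rewrite TK.
Qed.

Theorem proposition2p7 (R : realType) (l : nat)
    (alpha : forall E : 'I_l -> euclideanType R,
      (forall i, set (E i)) -> set (tensor E))
    (halpha : is_tensor_product alpha)
    (E F : 'I_l -> euclideanType R)
    (P : forall i, set (E i)) (hP : forall i, convex_body0 (P i))
    (T : forall i, {linear E i -> F i}) (hT : forall i, bijective (T i)) :
  tensor_map T @` alpha E P = alpha F (fun i => T i @` P i).
Proof.
have hTP i : convex_body0 (T i @` P i) by exact: convex_body0_image.
have invT i := cid (bijective_linear_inverse _ _ _ _ (hT i)).
pose S i := projT1 (invT i).
have TK i : cancel (T i) (S i) by case: (projT2 (invT i)).
have SK i : cancel (S i) (T i) by case: (projT2 (invT i)).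
apply/seteqP; split.
  exact: (tensor_uniform halpha hP hTP (fun i => @subset_refl _ _)).
move=> v alphav; exists (tensor_map S v); last exact: tensor_map_can.
have STP i : S i @` (T i @` P i) `<=` P i.
  by move=> _ [_ [x Px <-] <-]; rewrite TK.
by apply: (tensor_uniform halpha hTP hP STP); exists v.
Qed.
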